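(* Let $Q \ge 1$ be an integer (the number of qubits per node), let $\varepsilon \in (0,1)$ be a tolerance, and let $t = \lceil -\log_2(\varepsilon) \rceil$. Consider the distributed inverse quantum Fourier transform on nodes hosting $Q$ qubits each, where a communication block between two nodes at distance $d \ge 1$ is required (retained) if and only if it contains at least one controlled-phase gate whose index difference $k$ satisfies $k \le t$. Then the maximum required interaction distance between nodes, that is, the largest integer $d \ge 1$ for which the communication block at distance $d$ is required, is $$d_{\max} = \left\lfloor \frac{\lceil -\log_2(\varepsilon) \rceil - 1}{Q} \right\rfloor + 1 .$$
   Context: Nodes are indexed by integers $p \ge 0$, and each node hosts $Q$ qubits with local indices $q \in \{0,1,\dots,Q-1\}$. The global index of qubit $q$ of node $p$ is $I(q,p) = pQ + q$. In the inverse quantum Fourier transform, for every pair of qubits with global indices $I < J$, a controlled-phase gate with control $I$, target $J$ and angle $-\pi/2^{k}$ is applied, where $k = J - I$ is the index difference. For $d \ge 1$, the communication block at distance $d$ between a control node $p$ and the target node $p+d$ is the set of all $Q^2$ controlled-phase gates with control a qubit $q$ of node $p$ and target a qubit $q'$ of node $p+d$ ($q,q' \in \{0,\dots,Q-1\}$); such a gate has index difference $k = Qd + (q'-q)$. Whether a block is required depends only on $d$, not on $p$. The threshold $t = \lceil -\log_2 \varepsilon\rceil$ is such that gates with $k > t$ are considered negligible. A block is discarded in its entirety if all its gates have $k > t$, and otherwise is retained in its entirety. No a priori upper bound on the number of nodes is imposed in defining $d_{\max}$ (in a network of $P$ nodes only distances $d \le P-1$ occur). *)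

(* Defs.v *)
From HB Require Import structures.
From mathcomp Require Import all_boot all_order all_algebra.
From mathcomp Require Import all_classical all_reals all_analysis.

Set Implicit Arguments.
Unset Strict Implicit.
Unset Printing Implicit Defensive.

Import Order.TTheory GRing.Theory Num.Theory.
Local Open Scope classical_set_scope.
Local Open Scope ring_scope.

Definition log2 (R : realType) (x : R) : R := ln x / ln 2.

Definition threshold (R : realType) (eps : R) : int := Num.ceil (- log2 eps).

(* The pair (p, q) is the qubit of local index q on node p. *)
Definition qubit (Q : nat) : Type := (nat * 'I_Q)%type.

Definition global_index (Q : nat) (x : qubit Q) : nat := (x.1 * Q + x.2)%N.

Record cphase (R : realType) (Q : nat) := CPhase {
  control : qubit Q;
  target : qubit Q;
  angle : R
}.

(* Natural-number subtraction: exact on the gates of the circuit below, whose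
   control has a smaller global index than their target. *)
Definition index_difference (R : realType) (Q : nat) (g : cphase R Q) : nat :=
  (global_index (target g) - global_index (control g))%N.

(* Controlled-phase gates of the inverse QFT on an unbounded row of nodes. *)
Definition iqft_gates (R : realType) (Q : nat) : set (cphase R Q) :=
  [set g | (global_index (control g) < global_index (target g))%N /\
           angle g = - (pi / 2 ^+ index_difference g)].

(* For d >= 1 every qubit of node p precedes every qubit of node p + d, so
   this set consists of exactly Q ^ 2 gates. *)
Definition comm_block (R : realType) (Q p d : nat) : set (cphase R Q) :=
  [set g | iqft_gates g /\ (control g).1 = p /\ (target g).1 = (p + d)%N].

Definition block_required (R : realType) (Q : nat) (eps : R) (p d : nat) : Prop :=
  exists g : cphase R Q,
    comm_block p d g /\ (index_difference g)%:Z <= threshold eps.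

Definition is_max_distance (R : realType) (Q : nat) (eps : R) (p dmax : nat) : Prop :=
  [/\ (1 <= dmax)%N,
      block_required Q eps p dmax
    & forall d : nat, (1 <= d)%N -> block_required Q eps p d -> (d <= dmax)%N].

(* Main.v *)
(** The smallest index difference in the block at distance [d] is
    [Q * d - (Q - 1)], attained by the last qubit of the control node and the
    first qubit of the target node. The block is therefore required iff
    [Q * (d - 1) <= t - 1], i.e. iff [d - 1 <= floor ((t - 1) / Q)]. *)
Require Import Defs.
From HB Require Import structures.
From mathcomp Require Import all_boot all_order all_algebra.
From mathcomp Require Import all_classical all_reals all_analysis.
From mathcomp Require Import zify.
Import Order.TTheory GRing.Theory Num.Theory.
Local Open Scope ring_scope.

(** As [ln eps < 0 < ln 2], the ceiling is taken of a positive real. This allows the threshold to be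
    written [n.+1] with [n] natural. *)
Lemma threshold_gt0 (R : realType) (eps : R) :
  0 < eps -> eps < 1 -> 0 < threshold eps.
Proof.
move=> eps0 eps1; rewrite /threshold /log2 ceil_gt0 oppr_gt0.
by rewrite pmulr_llt0 ?invr_gt0 ?ln_gt0 ?ltr1n // ln_lt0 // eps0 eps1.
Qed.

(** Clearing the denominator turns the two bounds defining the floor into those of Euclidean
    division. *)
Lemma floor_divn (R : realType) (m n : nat) :
  (0 < n)%N -> Num.floor (m%:R / n%:R : R) = (m %/ n)%N%:Z.
Proof.
move=> n0; apply: floor_def; rewrite -[_ + 1]/((m %/ n)%N%:Z + 1%:Z) -PoszD.
rewrite -!pmulrn ler_pdivlMr ?ltr0n // ltr_pdivrMr ?ltr0n //.
by rewrite -!natrM ler_nat ltr_nat leq_divM addn1 ltn_ceil.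
Qed.

(** For local indices q and q', k = Q * (d - 1) + (Q - q) + q' with Q - q >= 1. *)
Lemma index_difference_ge (R : realType) (Q p d : nat) (g : cphase R Q) :
  (0 < d)%N -> comm_block p d g -> (Q * d.-1 < index_difference g)%N.
Proof.
case: d => // d _ [_ []]; rewrite /index_difference /global_index => -> ->.
by have := ltn_ord (control g).2; nia.
Qed.

Lemma index_difference_min (R : realType) (Q p d : nat) :
  (0 < Q)%N -> (0 < d)%N ->
  exists2 g : cphase R Q,
    comm_block p d g & index_difference g = (Q * d.-1).+1.
Proof.
case: Q d => [|Q] // [|d] // _ _.
set k := (Q.+1 * d).+1.
(* The angle is built from the expected difference [k], so the angle condition of [iqft_gates]
   reduces to [gk]. *)
set g := @CPhase R Q.+1 (p, ord_max) ((p + d.+1)%N, ord0) (- (pi / 2 ^+ k)).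
have gk : index_difference g = k.
  by rewrite /index_difference /global_index /k /=; nia.
exists g => //; split => //; split; last by rewrite gk.
by rewrite /global_index /=; nia.
Qed.

Lemma block_requiredE (R : realType) (Q : nat) (eps : R) (p d n : nat) :
  (0 < Q)%N -> (0 < d)%N -> threshold eps = n.+1 ->
  block_required Q eps p d <-> (d.-1 <= n %/ Q)%N.
Proof.
move=> Q0 d0 tn; rewrite leq_divRL // mulnC; split=> [[g [gd]]|le_n].
  rewrite tn lez_nat => gn; rewrite -ltnS.
  exact: leq_trans (index_difference_ge _ _ _ _ _ d0 gd) gn.
have [g gd gE] := index_difference_min R Q p d Q0 d0.
by exists g; split=> //; rewrite tn lez_nat gE ltnS.
Qed.

Theorem proposition1 (R : realType) (Q : nat) (eps : R)
    (hQ : (1 <= Q)%N) (heps0 : 0 < eps) (heps1 : eps < 1) :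
  exists dmax : nat,
    (forall p : nat, is_max_distance Q eps p dmax) /\
    dmax%:Z = Num.floor ((Num.ceil (- log2 eps) - 1)%:~R / Q%:R : R) + 1.
Proof.
have := threshold_gt0 _ _ heps0 heps1; case tE: (threshold eps) => [[|n]|] // _.
(* The bound [d.-1 <= n %/ Q], with n = t - 1, is an equality at this distance, whatever [p] is. *)
exists (n %/ Q).+1; split=> [p|].
  split=> // [|d d0]; first exact/(block_requiredE _ _ _ p _ _ hQ _ tE).
  by move/(block_requiredE _ _ _ p _ _ hQ d0 tE); case: d d0.
rewrite -/(threshold eps) tE.
have -> : n.+1%:Z - 1 = n%:Z by rewrite -addn1 PoszD addrK.
by rewrite -pmulrn floor_divn // -addn1 PoszD.
Qed.
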